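(* Let $B$ be a generalized Bratteli diagram and let $\mathcal{R}$ be the tail equivalence relation on the path space $X_B$. If $B$ is completely irreducible, then $\mathcal{R}$ is minimal.
   Context: A generalized Bratteli diagram is a graded graph $B=(V,E)$ with $V=\bigsqcup_{n\ge 0}V_n$ and $E=\bigsqcup_{n\ge 0}E_n$ such that: (i) each level $V_n$ and each edge set $E_n$ is countably infinite; (ii) there are source and range maps $s,r$ on $E$ with $s(E_n)=V_n$ and $r(E_n)=V_{n+1}$; (iii) $|r^{-1}(v)|<\infty$ for every $v\in V\setminus V_0$. Multiple edges are allowed. All levels $V_n$ are identified with one and the same countably infinite set (such as $\mathbb{N}$, $\mathbb{N}_0=\mathbb{N}\cup\{0\}$ or $\mathbb{Z}$); this enumeration is part of the data. A finite path from $w\in V_n$ to $v\in V_m$ ($m>n$) is a sequence of edges $(e_n,\dots,e_{m-1})$, $e_k\in E_k$, with $s(e_n)=w$, $s(e_k)=r(e_{k-1})$, $r(e_{m-1})=v$. The path space $X_B$ is the set of all infinite paths $x=(x_n)_{n\ge0}$, $x_n\in E_n$, $s(x_{n+1})=r(x_n)$, with the topology generated by the cylinder sets $[(e_0,\dots,e_n)]=\{x\in X_B: x_0=e_0,\dots,x_n=e_n\}$. Two paths $x,y\in X_B$ are tail equivalent, $(x,y)\in\mathcal{R}$, if there is $n$ with $x_i=y_i$ for all $i\ge n$. The orbit of $x$ is $\mathcal{O}(x)=\{y\in X_B:(x,y)\in\mathcal{R}\}$. $\mathcal{R}$ is minimal if the orbit of every point of $X_B$ is dense in $X_B$. $B$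 is irreducible if, with all levels identified with the set $V_0$, for any $i,j\in V_0$ and any $n\in\mathbb{N}_0$ there exists $m>n$ such that there is a finite path from $i\in V_n$ to $j\in V_m$. Two diagrams $B=(V,E)$ and $B'=(V',E')$ are isomorphic if there are bijections $g_n:V_n\to V_n'$ and $h_n:E_n\to E_n'$ for all $n\in\mathbb{N}_0$ with $s'\circ h_n=g_n\circ s$ and $r'\circ h_n=g_{n+1}\circ r$ on $E_n$. (The bijections $g_n$ are not required to be compatible with the identifications of different levels.) $B$ is completely irreducible if every generalized Bratteli diagram isomorphic to $B$ is irreducible. *)

(* Defs.v *)
From HB Require Import structures.
From mathcomp Require Import all_boot.
From mathcomp Require Import boolp classical_sets functions cardinality filter.
From mathcomp Require Import topology.

Set Implicit Arguments.
Unset Strict Implicit.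
Unset Printing Implicit Defensive.

Local Open Scope classical_set_scope.
Local Open Scope card_scope.

(* All levels are identified with one countably infinite set [vertex]: the
   vertex of level n with label i : vertex is the pair (n, i). The level is
   carried by the indices of [src] and [rng]: [src n] takes its values in V_n
   and [rng n] in V_(n+1). *)
Record bratteli := Bratteli {
  vertex : Type;
  edge : nat -> Type;
  src : forall n, edge n -> vertex;
  rng : forall n, edge n -> vertex;
  vertex_infinite : [set: vertex] #= [set: nat];
  edge_infinite : forall n, [set: edge n] #= [set: nat];
  src_onto : forall n, range (@src n) = [set: vertex];
  rng_onto : forall n, range (@rng n) = [set: vertex];
  rng_finite : forall n (v : vertex), finite_set (@rng n @^-1` [set v])
}.

Arguments src {b n} _.
Arguments rng {b n} _.

Section Diagram.
Variable B : bratteli.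

(* (e n, ..., e (m - 1)) is a finite path from w in V_n to v in V_m. Only these
   coordinates of e matter; since no E_k is empty, every finite sequence of
   edges is of this form. *)
Definition finite_path (n : nat) (w : vertex B) (m : nat) (v : vertex B)
    (e : forall k, edge B k) : Prop :=
  [/\ (n < m)%N, src (e n) = w,
      forall k, (n < k.+1)%N -> (k.+1 < m)%N -> src (e k.+1) = rng (e k)
    & rng (e m.-1) = v].

Definition irreducible : Prop :=
  forall (i j : vertex B) (n : nat),
    exists2 m, (n < m)%N & exists e, finite_path n i m j e.

Record path_space := PathSpace {
  path_edge :> forall n, edge B n;
  path_edgeP : forall n, src (path_edge n.+1) = rng (path_edge n)
}.

Definition cylinder (n : nat) (e : forall k, edge B k) : set path_space :=
  [set x | forall k, (k <= n)%N -> x k = e k].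

Definition cylinders : set (set path_space) :=
  [set C | exists n e, (exists w v, finite_path 0 w n.+1 v e)
                       /\ C = cylinder n e].

HB.instance Definition _ := gen_eqMixin path_space.
HB.instance Definition _ := gen_choiceMixin path_space.
HB.instance Definition _ :=
  isSubBaseTopological.Build path_space cylinders id.

Definition tail_equiv (x y : path_space) : Prop :=
  exists n, forall i, (n <= i)%N -> x i = y i.

End Diagram.

Definition orbit {T : Type} (R : T -> T -> Prop) (x : T) : set T :=
  [set y | R x y].

Definition minimal {T : topologicalType} (R : T -> T -> Prop) : Prop :=
  forall x : T, dense (orbit R x).

Definition isomorphic (B B' : bratteli) : Prop :=
  exists (g : nat -> vertex B -> vertex B')
         (h : forall n, edge B n -> edge B' n),
    [/\ forall n, bijective (g n),
        forall n, bijective (@h n),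
        forall n (e : edge B n), src (h n e) = g n (src e)
      & forall n (e : edge B n), rng (h n e) = g n.+1 (rng e)].

Definition completely_irreducible (B : bratteli) : Prop :=
  forall B' : bratteli, isomorphic B B' -> irreducible B'.

(* Main.v *)
From mathcomp Require Import all_boot finmap.
From mathcomp Require Import boolp classical_sets cardinality topology.
Require Import Defs.

(** Fix a path x. Relabelling the m-th level by the transposition of s(x_m) with
    a fixed vertex j gives an isomorphic diagram in which x runs through j at
    every level. Its irreducibility says that from any vertex of any level some
    finite path leads to s(x_m) for some later m; appending such a path and the
    tail of x to an initial segment of y gives a point of the orbit of x in the
    corresponding cylinder around y. *)

Set Implicit Arguments.
Unset Strict Implicit.
Unset Printing Implicit Defensive.

Local Open Scope classical_set_scope.

Section Swap.
Variables (T : Type) (a b : T).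

(** Equality in the bare type [T] is decided classically. For [a = b] this is the identity. *)
Definition swap (x : T) : T :=
  if pselect (x = a) then b else if pselect (x = b) then a else x.

Lemma swapl : swap a = b.
Proof. by rewrite /swap; case: pselect. Qed.

Lemma swapK : involutive swap.
Proof. by move=> x; rewrite /swap; do !case: pselect => //=; congruence. Qed.

End Swap.

Section Relabel.
Variables (B : bratteli) (g : nat -> vertex B -> vertex B).
Hypothesis gK : forall n, involutive (g n).

Lemma relabel_onto n E (f : E -> vertex B) :
  range f = [set: vertex B] -> range (g n \o f) = [set: vertex B].
Proof.
move=> f_onto; rewrite -subTset => v _.
have [e _ fe] : range f (g n v) by rewrite f_onto.
by exists e => //=; rewrite fe gK.
Qed.

Lemma relabel_rng_finite n (v : vertex B) :
  finite_set ((g n.+1 \o @rng B n) @^-1` [set v]).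
Proof.
apply: (sub_finite_set _ (@rng_finite B n (g n.+1 v))) => e /= <-.
by rewrite gK.
Qed.

Definition relabel : bratteli :=
  Bratteli (@vertex_infinite B) (@edge_infinite B)
    (fun n => relabel_onto n (@src_onto B n))
    (fun n => relabel_onto n.+1 (@rng_onto B n)) relabel_rng_finite.

Lemma relabel_isomorphic : isomorphic B relabel.
Proof.
exists g, (fun=> id); split=> n //.
- by exists (g n); exact: gK.
- by exists id.
Qed.

Lemma relabel_path n i m j (e : forall k, edge B k) : (n < m)%N ->
  @finite_path relabel n (g n i) m (g m j) e -> finite_path n i m j e.
Proof.
move=> nm [_ /(can_inj (gK n)) srce ee rnge]; split=> //.
  by move=> k nk km; have /(can_inj (gK k.+1)) := ee k nk km.
(* The last range is relabelled by [g m.-1.+1], which is [g m] because [n < m] makes [m]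
   positive. *)
by move: rnge; case: m nm {ee} => // m _ /(can_inj (gK m.+1)).
Qed.

End Relabel.

Lemma completely_irreducible_reach (B : bratteli) (v : nat -> vertex B)
    (i : vertex B) n : completely_irreducible B ->
  exists2 m, (n < m)%N & exists e, finite_path n i m (v m) e.
Proof.
move=> hB; pose g m := swap (v m) (v 0).
have gK m : involutive (g m) by exact: swapK.
(* The vertex [v m] has the new label [v 0] at every level [m], so the target can be named before
   [m] is known. *)
have [m nm [e ep]] := hB _ (relabel_isomorphic gK) (g n i) (v 0) n.
exists m => //; exists e; apply: (@relabel_path _ _ gK _ _ _ _ e nm).
by rewrite {3}/g swapl.
Qed.

Section PathSpace.
Variable B : bratteli.
Implicit Types x y z : path_space B.

(** Around [y], an open set contains a finite intersection of cylinders through [y]. Each of these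
    may be recentred at [y], and then the longest lies in all the others. *)
Lemma cylinder_neighborhood (U : set (path_space B)) y :
  open U -> U y -> exists n, cylinder n y `<=` U.
Proof.
case=> /= D DI <- [A DA Ay]; have [F Fcyl AE] := DI _ DA.
have FA : forall C, C \in F -> exists n, cylinder n y `<=` C.
  move=> C CF; have [n [e [_ CE]]] : cylinders C.
    by have := Fcyl C CF; rewrite inE.
  have Cy : C y by move: Ay; rewrite -AE; exact.
  exists n; rewrite CE in Cy * => z zy k kn.
  by rewrite (zy k kn) (Cy k kn).
have [|N NP] := @choice _ _ (fun C n => C \in F -> cylinder n y `<=` C).
  (* Outside [F] the length 0 is a dummy value. *)
  by move=> C; case: (boolP (C \in F)) => [/FA [n]|]; [exists n|exists 0].
exists (\max_(C <- F) N C) => z zy; exists A => //; rewrite -AE => C CF.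
apply: (NP C CF) => k kN; apply: zy.
exact: leq_trans kN (leq_bigmax_seq _ CF _).
Qed.

Lemma path_splice x y n m (e : forall k, edge B k) :
  (n.+1 < m)%N -> finite_path n.+1 (rng (y n)) m (src (x m)) e ->
  exists z, cylinder n y z /\ forall k, (m <= k)%N -> z k = x k.
Proof.
move=> nm [_ srce ee rnge].
pose f k := if (k <= n)%N then y k else if (k < m)%N then e k else x k.
(* The only new junctions are [k = n], where [y] meets [e], and [k.+1 = m], where [e] meets [x]. *)
have fP k : src (f k.+1) = rng (f k).
  rewrite /f; case: (ltngtP k n) => [kn|nk|->].
  - exact: path_edgeP.
  - case: (ltngtP k.+1 m) => [km|mk|km].
    + by rewrite ee.
    + exact: path_edgeP.
    + by rewrite km -rnge -km.
  - by rewrite nm srce.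
exists (PathSpace fP); split=> k /= kn; rewrite /f.
  by rewrite kn.
by rewrite !ifF //; apply/negbTE; rewrite -?leqNgt -?ltnNge //;
  apply: leq_trans kn; exact: ltnW.
Qed.

End PathSpace.

Theorem theorem4p14 (B : bratteli) (hB : completely_irreducible B) :
  minimal (@tail_equiv B).
Proof.
move=> x U [y Uy] Uopen.
have [n nU] := cylinder_neighborhood Uopen Uy.
(* The cylinder fixes the edges 0 to [n] of [y], so the connecting path must start at level
   [n.+1]. *)
have [m nm [e ep]] :=
  completely_irreducible_reach (fun k => src (x k)) (rng (y n)) n.+1 hB.
have [z [yz zx]] := path_splice nm ep.
exists z; split; first exact: nU.
by exists m => i mi; rewrite zx.
Qed.
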